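(* Let $G$ be a finite abelian group with $n$ elements, and let $S\subseteq G$ be a generating set of $G$ with $S=-S$ and $0_G\notin S$. Let $p$ be the smallest prime factor of $n$. (1) If $p=3$, then $c(\mathrm{Cay}(G,S))\le \sqrt{\dfrac{3}{2(\sqrt{3}-1)\,e}}\,\sqrt{n}+\dfrac72$. (2) If $p\ge 5$, then $c(\mathrm{Cay}(G,S))\le \sqrt{\dfrac{2}{e}}\,\sqrt{n}+\dfrac72$.
   Context: Cops and robbers is played on a finite connected graph. First each cop chooses a starting vertex, then the robber chooses a starting vertex. Then cop turns and robber turns alternate, starting with a cop turn. On a cop turn each cop moves to a neighbouring vertex or stays where it is; on a robber turn the robber does likewise. Several cops may share a vertex, and all players have full information. The cops win if at some point a cop shares a vertex with the robber; the robber wins if this never happens. The cop number $c(\Gamma)$ is the minimum number of cops for which the cops have a winning strategy on $\Gamma$. For a finite abelian group $(G,+)$ and a generating set $S$ with $0_G\notin S$ and $S=-S$, $\mathrm{Cay}(G,S)$ is the undirected graph with vertex set $G$ in which $u,v$ are adjacent iff $v-u\in S$. Here $e$ is the base of the natural logarithm. *)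

(* Defs.v *)
From HB Require Import structures.
From mathcomp Require Import all_boot all_order all_fingroup all_algebra.
From mathcomp Require Import boolp.

Set Implicit Arguments.
Unset Strict Implicit.
Unset Printing Implicit Defensive.

Import Order.TTheory GRing.Theory Num.Theory.
Local Open Scope ring_scope.

Section CopsAndRobbers.
Variables (V : finType) (e : rel V).

Definition cr_step (u v : V) : bool := (u == v) || e u v.

(* A strategy for k cops reads the list [:: r_0; ...; r_(t-1)] of the robber's
   positions so far (r_0 being the starting vertex) and returns the positions
   of the cops after t cop turns; on the empty list it returns the starting
   vertices. The earlier cop positions need not be an argument: the strategy
   itself determines them from the prefixes of this list. *)
Definition cop_strategy (k : nat) := seq V -> 'I_k -> V.

Definition legal_cops (k : nat) (sigma : cop_strategy k) : Prop :=
  forall (h : seq V) (v : V) (i : 'I_k), cr_step (sigma h i) (sigma (rcons h v) i).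

Definition legal_robber (r : nat -> V) : Prop :=
  forall t : nat, cr_step (r t) (r t.+1).

(* Some cop meets r_t: either at once, when the robber arrives at r_t (or
   starts there), or after the cop turn that follows. *)
Definition captures (k : nat) (sigma : cop_strategy k) (r : nat -> V) : Prop :=
  exists (t : nat) (i : 'I_k),
    sigma (mkseq r t) i = r t \/ sigma (mkseq r t.+1) i = r t.

Definition cops_win (k : nat) : Prop :=
  exists sigma : cop_strategy k,
    legal_cops sigma /\ forall r, legal_robber r -> captures sigma r.

Lemma ex_cops_win : exists k, `[< cops_win k >].
Proof.
exists #|V|; apply/asboolP; exists (fun _ i => enum_val i); split.
  by move=> h v i; rewrite /cr_step eqxx.
by move=> r _; exists 0%N, (enum_rank (r 0%N)); left; rewrite enum_rankK.
Qed.

Definition cop_number : nat := ex_minn ex_cops_win.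

Lemma cop_numberP :
  cops_win cop_number /\ forall k, cops_win k -> (cop_number <= k)%N.
Proof.
rewrite /cop_number; case: ex_minnP => m /asboolP win_m min_m.
by split=> // k /asboolP /min_m.
Qed.

End CopsAndRobbers.

Definition Cay (G : finZmodType) (S : {set G}) : rel G :=
  fun u v => v - u \in S.

(* Main.v *)
Require Import Defs.
From HB Require Import structures.
From mathcomp Require Import all_boot all_order all_fingroup all_algebra.
From mathcomp Require Import boolp reals sequences exp.
From mathcomp Require Import zify ring lra.

Set Implicit Arguments.
Unset Strict Implicit.
Unset Printing Implicit Defensive.

Import Order.TTheory GRing.Theory Num.Theory.
Local Open Scope ring_scope.

(** Let [A = {0} \cup S] be the set of moves (including staying put), and play
    the game modulo a subgroup [H], recording only the differences robber - cop.
    If a cop has caught the robber modulo [<H, d>], then it can mirror the robber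
    and answer any move [a] with [a + d] as soon as [a + d] is a legal move
    modulo [H]; this brings it closer to the robber in [<H, d> / H], so the robber
    can use such moves only finitely often. Spending one cop therefore deletes
    from the robber's repertoire all [a] with [a + d] in [A + H].

    Frankl's choice [d = - (a + b)] deletes two moves per cop; averaging over
    [d] outside [H] deletes about a fraction [|A| / |G|] of the moves. With [m] the
    index of [H], use averaging [c sqrt m] times, which leaves at most
    [1 + sqrt m / (c e)] moves since [x exp(-x) <= 1/e], and then Frankl's choice.
    Catching the robber modulo [<H, d>], of index at most [m / p], is done by
    induction, and there are enough free cops for it if [c + C / sqrt p <= C].
    The total is [C = c + 1 / (2 c e)] times [sqrt m]; take [c = C / 2] for
    [p >= 5] and [c = C (1 - 1 / sqrt 3)] for [p = 3]. *)

(** * Subgroups in additive notation and their cosets *)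

Section Subgroups.
Variables (G : finZmodType) (H : {group G}).
Implicit Types x y : G.

Lemma subgroup0 : 0 \in H.
Proof. exact: (group1 H). Qed.

Lemma subgroupD x y : x \in H -> y \in H -> x + y \in H.
Proof. exact: (@groupM _ H x y). Qed.

Lemma subgroupN x : x \in H -> - x \in H.
Proof. by move=> xH; rewrite -FinRing.zmodVgE groupV. Qed.

Lemma subgroupB x y : x \in H -> y \in H -> x - y \in H.
Proof. by move=> xH yH; apply: subgroupD => //; apply: subgroupN. Qed.

Lemma subgroup_congC x y : x - y \in H -> y - x \in H.
Proof. by move/subgroupN; rewrite opprB. Qed.

Lemma subgroup_cong_trans x y z : x - y \in H -> y - z \in H -> x - z \in H.
Proof. by move=> xy yz; rewrite -(subrKA y) addrC subgroupD. Qed.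

Lemma mem_join_cycle d x :
  x \in (H <*> <[d]>)%g -> exists j, x - d *+ j \in H.
Proof.
rewrite norm_joinEr; last first.
  apply/subsetP => y _; apply/normP/setP => z.
  by rewrite mem_conjg conjgE (FinRing.zmod_mulgC z) mulgA mulVg mul1g.
case/mulsgP => h _ hH /cycleP[j ->] ->; exists j.
by rewrite FinRing.zmodXgE FinRing.zmodMgE addrK.
Qed.

(** The sumset [A + H]. *)
Definition coset_cover (A : {set G}) : {set G} :=
  [set x | [exists y in A, x - y \in H]].

Lemma coset_coverP (A : {set G}) x :
  reflect (exists2 y, y \in A & x - y \in H) (x \in coset_cover A).
Proof. by rewrite inE; apply: exists_inP. Qed.

(** Keep one element of [A] from each coset of [H] that meets [A]; the kept cosets are disjoint and
    lie in [A + H]. *)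
Lemma coset_cover_transversal (A : {set G}) :
  exists X : {set G}, [/\ X \subset A, A \subset coset_cover X
    & (#|X| * #|H| <= #|coset_cover A|)%N].
Proof.
pose P x y := (y \in A) && (x - y \in H).
pose f x := odflt x [pick y | P x y].
have fP x : x \in A -> P x (f x).
  rewrite /f => xA; case: pickP => //= /(_ x).
  by rewrite /P xA subrr subgroup0.
(* [pick] depends only on the extension of its predicate, which congruent elements share. *)
have f_eq x y : x \in A -> x - y \in H -> f x = f y.
  move=> xA xyH; rewrite /f.
  have -> : [pick z | P y z] = [pick z | P x z].
    apply: eq_pick => z; rewrite /P; congr (_ && _).
    by apply/idP/idP; apply: subgroup_cong_trans => //; apply: subgroup_congC.
  case: pickP => //= /(_ x).
  by rewrite /P xA subrr subgroup0.
exists (f @: A); split.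
- by apply/subsetP => _ /imsetP[x xA ->]; have /andP[] := fP x xA.
- apply/subsetP => x xA; apply/coset_coverP; exists (f x); first exact: imset_f.
  by have /andP[] := fP x xA.
- rewrite -cardsX -(card_in_imset (f := fun u : G * G => u.1 + u.2)).
    apply/subset_leq_card/subsetP => _ /imsetP[[y h] /setXP[/imsetP[x xA ->] hH] ->] /=.
    apply/coset_coverP; exists (f x); first by have /andP[] := fP x xA.
    by rewrite addrC addKr.
  move=> [y1 h1] [y2 h2] /setXP[/imsetP[x1 x1A ->] h1H]
    /setXP[/imsetP[x2 x2A ->] h2H] /= E.
  have /andP[_ Q1] := fP _ x1A; have /andP[_ Q2] := fP _ x2A.
  have F : f x1 = f x2.
    apply: f_eq => //.
    apply: subgroup_cong_trans Q1 (subgroup_cong_trans _ (subgroup_congC Q2)).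
    by rewrite -[f x1](addrK h1) E addrAC (addrC (f x2)) addrK subgroupB.
  by move: E; rewrite F => /addrI ->.
Qed.

End Subgroups.

(** * The game of differences, and how a cop deletes moves of the robber *)

Section DifferenceGame.
Variables (G : finZmodType) (A : {set G}).

(* The state is the family of differences (robber - cop), with the robber to
   move; the robber is restricted to translations by T, the cops move by A,
   and the cops aim to bring some difference into H, that is, to catch the
   robber modulo H. *)
Inductive wins (H T : {set G}) (k : nat) : ('I_k -> G) -> Prop :=
| wins_now (delta : 'I_k -> G) i of delta i \in H : wins H T delta
| wins_step (delta : 'I_k -> G) (s : G -> 'I_k -> G)
    of (forall a i, a \in T -> s a i \in A)
     & (forall a, a \in T -> wins H T (fun i => delta i + a - s a i)) :
    wins H T delta.

Definition forces (H T : {set G}) (k : nat) : Prop :=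
  forall delta : 'I_k -> G, wins H T delta.

(** Splices two games: the cops first reach [H'], then carry on from whatever differences result. *)
Lemma wins_trans (H H' T : {set G}) k (delta : 'I_k -> G) :
  (forall (d : 'I_k -> G) i, d i \in H' -> wins H T d) ->
  wins H' T delta -> wins H T delta.
Proof.
move=> HH'; elim=> {delta} [delta i /HH' //|delta s sA _ IH].
exact: wins_step sA IH.
Qed.

Lemma forces_sub (H T T' : {set G}) k :
  T \subset T' -> forces H T' k -> forces H T k.
Proof.
move=> /subsetP TT' F delta; elim: {F}(F delta) => {}delta.
  by move=> i; exact: wins_now.
move=> s sA _ IH; apply: (wins_step (s := s)) => a; last by move/TT'/IH.
by move=> i /TT'/sA.
Qed.

(** A robber with no permitted move leaves nothing to answer, so deleting all moves wins. *)
Lemma forces0 (H : {set G}) k : forces H set0 k.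
Proof.
by move=> delta; apply: (wins_step (s := fun _ _ => 0)) => a; rewrite inE.
Qed.

(* A cop caught up modulo <H, d> mirrors the robber, except that it answers a
   with a + d (modulo H) whenever that is a legal move; this can happen only
   finitely often before its difference enters H. *)
Lemma forces_commit (H : {group G}) (T T' : {set G}) (d : G) k :
  T \subset A ->
  (forall a, a \in T -> a + d \notin coset_cover H A -> a \in T') ->
  forces (H <*> <[d]>)%g T k.+1 -> forces H T' k -> forces H T k.+1.
Proof.
move=> /subsetP TA TT' F F' delta; apply: wins_trans (F delta) => {F}{}delta i.
case/mem_join_cycle => j; elim: j delta => [|j IHj] delta.
  by rewrite mulr0n subr0; exact: wins_now.
(* Inner induction on the win of the other cops against [T']. A move answered with [a + d] lowers
   [j] instead; that win is then restarted from the new differences. *)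
move=> dH; move: (F' (fun l => delta (lift i l))).
move E: (fun l => delta (lift i l)) => eps W.
elim: W delta dH E => {eps} [eps l el|eps s sA _ IH] delta dH E.
  by move: el; rewrite -E; exact: wins_now.
pose u a := odflt 0 [pick y | (y \in A) && (a + d - y \in H)].
pose s' a l := if a + d \in coset_cover H A then
  (if l == i then u a else a) else (if unlift i l is Some l' then s a l' else a).
have uP a : a + d \in coset_cover H A -> (u a \in A) && (a + d - u a \in H).
  case/coset_coverP => y yA yH; rewrite /u.
  by case: pickP => //= /(_ y); rewrite yA yH.
apply: (wins_step (s := s')) => a; rewrite /s'.
  move=> l aT; case: ifPn => [/uP/andP[uA _]|aN]; first by case: eqP => // _; exact: TA.
  by case: unlift => [l'|]; [apply: sA; apply: TT' | apply: TA].
move=> aT; case: (boolP (a + d \in coset_cover H A)) => [/uP/andP[uA uH]|aN].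
  apply: IHj; rewrite eqxx.
  have -> : delta i + a - u a - d *+ j = (delta i - d *+ j.+1) + (a + d - u a).
    rewrite mulrS opprD !addrA [RHS](ACl (1*4*6*3*(5*2)))/=.
    by rewrite subrr addr0.
  exact: subgroupD.
apply: (IH a (TT' _ aT aN)); first by rewrite unlift_none addrK.
by apply/funext => l; rewrite liftK -E.
Qed.

Hypothesis A_opp : forall a, a \in A -> - a \in A.
Hypothesis A0 : 0 \in A.
Hypothesis A_gen : <<A>>%g = [set: G].

Lemma gen_not_in_coset (H : {group G}) a :
  H != [set: G] :> {set G} -> exists2 s, s \in A & s - a \notin H.
Proof.
move=> HT; apply/exists_inP; apply: contraT.
rewrite negb_exists_in => /forall_inP AH; case/negP: HT.
rewrite eqEsubset subsetT -A_gen gen_subG; apply/subsetP => s sA.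
have := AH _ sA; have := AH _ A0; rewrite !negbK => h0 hs.
by have := subgroupB hs h0; rewrite sub0r opprK subrK.
Qed.

(** [X] serves as a list of representatives, so that moves are counted modulo [H]. *)
Definition moves (H : {group G}) (X : {set G}) : {set G} :=
  A :&: coset_cover H X.

Lemma moves_commit (H : {group G}) (X : {set G}) (d : G) k :
  forces (H <*> <[d]>)%g (moves H X) k.+1 ->
  forces H (moves H [set x in X | x + d \notin coset_cover H A]) k ->
  forces H (moves H X) k.+1.
Proof.
apply: forces_commit; first exact: subsetIl.
move=> a /setIP[aA /coset_coverP[x xX xH]] aN; apply/setIP; split=> //.
apply/coset_coverP; exists x => //; rewrite inE xX /=.
apply: contra aN => /coset_coverP[y yA yH]; apply/coset_coverP; exists y => //.
by apply: subgroup_cong_trans yH; rewrite opprD addrACA subrr addr0.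
Qed.

Lemma moves_sub (H H' : {group G}) (X Y : {set G}) :
  H \subset H' -> X \subset Y -> moves H X \subset moves H' Y.
Proof.
move=> /subsetP HH' /subsetP XY; apply/setIS/subsetP => a.
by case/coset_coverP => x /XY xY /HH' axH; apply/coset_coverP; exists x.
Qed.

Lemma forces_full (H T : {set G}) k :
  H = [set: G] -> (0 < k)%N -> forces H T k.
Proof.
by move=> -> k0 delta; apply: (@wins_now _ _ _ _ (Ordinal k0)); rewrite inE.
Qed.

Lemma join_cycle_proper (H : {group G}) d :
  d \notin H -> H \proper (H <*> <[d]>)%g.
Proof.
move=> dH; rewrite properE joing_subl /=; apply: contra dH => /subsetP; apply.
by apply: (subsetP (joing_subr _ _)); exact: cycle_id.
Qed.

(* Frankl: taking d = - (a + b), a single cop stops both moves a and b *)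
Lemma forces_half (H : {group G}) (X : {set G}) k :
  X \subset A -> (X != set0 -> #|X|./2 < k)%N -> forces H (moves H X) k.
Proof.
(* Every recursive call shrinks [X] or enlarges [H]. *)
have [N] := ubnP (#|X| + #|~: H|)%N.
elim: N H X k => // N IH H X k; rewrite ltnS => leN XA kX.
have [X0|[a aX]] := set_0Vmem X.
  apply: forces_sub _ (@forces0 H k); apply/subsetP => x.
  by case/setIP => _ /coset_coverP[y]; rewrite X0 inE.
have {}kX : (#|X|./2 < k)%N by apply: kX; apply/set0Pn; exists a.
have [HT|HT] := eqVneq (H : {set G}) [set: G].
  by apply: forces_full => //; exact: leq_ltn_trans kX.
case: k kX => // k; rewrite ltnS => kX.
have commit d : d \notin H ->
    forces H (moves H [set x in X | x + d \notin coset_cover H A]) k ->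
    forces H (moves H X) k.+1.
  move=> dH; apply: moves_commit.
  have HH' := join_cycle_proper dH.
  have F : forces (H <*> <[d]>)%G (moves (H <*> <[d]>)%G X) k.+1.
    apply: IH => //.
    apply: leq_trans leN; rewrite ltn_add2l; apply: proper_card.
    by rewrite properC; exact: HH'.
  exact: forces_sub (moves_sub (proper_sub HH') (subxx _)) F.
have sub d (Y : {set G}) : Y \subset X ->
  (forall x, x \in Y -> x + d \in coset_cover H A) ->
  [set x in X | x + d \notin coset_cover H A] \subset X :\: Y.
  move=> YX Yd; apply/subsetP => x; rewrite !inE => /andP[-> xd]; rewrite andbT.
  by apply: contra xd => /Yd; rewrite inE.
have card_sub (Y Z : {set G}) : Y \subset Z -> Z \subset X ->
  forall y, y \in X -> y \notin Z ->
  (#|Y| + #|~: H| < N)%N.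
  move=> YZ ZX y yX yZ; apply: leq_trans leN; rewrite ltn_add2r.
  apply: leq_ltn_trans (subset_leq_card YZ) _; apply: proper_card.
  by rewrite properE ZX; apply: contra yZ => /subsetP; apply.
have [/existsP[b /and3P[bX ba abH]]|nb] :=
  boolP [exists b, [&& b \in X, b != a & a + b \notin H]].
  have Yd : forall x, x \in [set a; b] -> x + (- (a + b)) \in coset_cover H A.
    move=> x; rewrite !inE => /orP[] /eqP ->; apply/exists_inP.
      exists (- b); first by apply: A_opp; exact: (subsetP XA).
      by rewrite opprD opprK addrA subrr add0r addNr subgroup0.
    exists (- a); first by apply: A_opp; exact: (subsetP XA).
    by rewrite opprD opprK addrCA subrr addr0 addNr subgroup0.
  have YX : [set a; b] \subset X by apply/subsetP => x; rewrite !inE => /orP[] /eqP ->.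
  have S' := sub _ _ YX Yd.
  apply: (commit (- (a + b))).
    by apply: contra abH => /subgroupN; rewrite opprK.
  apply: IH.
  - apply: (card_sub _ _ S' (subsetDl _ _) a) => //.
    by rewrite !inE eqxx.
  - by apply: subset_trans XA; apply: subset_trans S' (subsetDl _ _).
  - move=> Y0; have := subset_leq_card S'; rewrite cardsDS // cards2 eq_sym ba /=.
    by move: Y0 kX; rewrite -card_gt0; move: #|_| #|X| => y x; lia.
have ab b : b \in X -> b != a -> a + b \in H.
  move=> bX ba; apply: contraNT nb => abH; apply/existsP; exists b.
  by rewrite bX ba.
(* No shift outside [H] of the form [- (a + b)] is available. For at most two moves, stopping [a]
   alone already suffices. *)
have [X2|X3] := leqP #|X| 2.
  have [s sA saH] := gen_not_in_coset a HT.
  have YX : [set a] \subset X by rewrite sub1set.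
  have Yd : forall x, x \in [set a] -> x + (s - a) \in coset_cover H A.
    move=> x; rewrite inE => /eqP ->; apply/coset_coverP; exists s => //.
    by rewrite addrCA subrr addr0 subrr subgroup0.
  have S' := sub _ _ YX Yd.
  apply: (commit (s - a)) => //; apply: IH.
  - apply: (card_sub _ _ S' (subsetDl _ _) a) => //.
    by rewrite !inE eqxx.
  - by apply: subset_trans XA; apply: subset_trans S' (subsetDl _ _).
  - move=> Y0; have := subset_leq_card S'; rewrite cardsDS // cards1.
    by move: Y0 X2 kX; rewrite -card_gt0; move: #|_| #|X| => y x; lia.
(* all elements of X other than a lie in the coset - a + H *)
have: (1 < #|X :\ a|)%N by move: X3; rewrite (cardsD1 a X) aX.
case/card_gt1P => b [c [/setD1P[ba bX] /setD1P[ca cX] bc]].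
(* [b] and [c] are congruent modulo [H], so [c] is redundant and costs no cop. *)
apply: forces_sub _ (IH H (X :\ c) k.+1 _ _ _).
- apply/setIS/subsetP => x /coset_coverP[y yX xy]; apply/coset_coverP.
  have [yc|yc] := eqVneq y c; last by exists y; rewrite // !inE yc.
  exists b; first by rewrite !inE bc.
  apply: subgroup_cong_trans xy _; rewrite yc.
  have := subgroupB (ab c cX ca) (ab b bX ba).
  by rewrite opprD addrACA subrr add0r.
- by apply: (card_sub _ _ (subxx _) (subsetDl _ _) c); rewrite // !inE eqxx.
- exact: subset_trans (subsetDl _ _) XA.
- by move=> _; move: kX; rewrite (cardsD1 c X) cX; move: #|_| => x; lia.
Qed.

(** Double counting of pairs [(x, d)] with [x + d] outside [A + H]: for fixed [x], translation by
    [x] is injective, so each [x] survives for at most [|G| - |A + H|] shifts. *)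
Lemma exists_good_shift (H : {group G}) (X : {set G}) :
  H != [set: G] :> {set G} ->
  exists2 d, d \notin H &
    (#|[set x in X | (x + d)%R \notin coset_cover H A]| * (#|G| - #|H|)
       <= #|X| * (#|G| - #|coset_cover H A|))%N.
Proof.
move=> HT; set B := coset_cover H A.
have cardC (Z : {set G}) : (#|G| - #|Z| = #|~: Z|)%N by rewrite -(cardsC Z) addKn.
rewrite !cardC; apply/exists_inP; apply: contraT.
rewrite negb_exists_in => /forall_inP nd.
have : (\sum_(d in ~: H) #|[set x in X | (x + d)%R \notin B]| * #|~: H|
          <= #|X| * #|~: B| * #|~: H|)%N.
  rewrite -big_distrl /= leq_mul2r; apply/orP; right.
  have E d : #|[set x in X | x + d \notin B]| =
      (\sum_(x in X) if (x + d)%R \notin B then 1 else 0)%N.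
    by rewrite -big_mkcondr /= sum1dep_card.
  rewrite (eq_bigr _ (fun d _ => E d)) exchange_big /= -sum_nat_const.
  apply: leq_sum => x xX; rewrite -big_mkcondr /= sum1dep_card.
  rewrite -(card_imset _ (addrI x)); apply/subset_leq_card/subsetP => y /imsetP[d].
  by rewrite inE => /andP[_ ?] ->; rewrite inE.
apply: contraLR => _; rewrite -ltnNge mulnC -sum_nat_const.
(* A nonempty index set is what makes the sum of strict inequalities strict. *)
have [d0 d0H] : exists d, d \in ~: H.
  apply/set0Pn; apply: contra HT => /eqP/(congr1 (fun Z => ~: Z)).
  by rewrite setCK setC0 => ->.
rewrite [X in (X < _)%N](bigD1 d0) // [X in (_ < X)%N](bigD1 d0) //=.
rewrite -addSn leq_add //.
  by rewrite ltnNge; apply: nd; move: d0H; rewrite inE.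
apply: leq_sum => d /andP[dH _]; apply: ltnW; rewrite ltnNge; apply: nd.
by move: dH; rewrite inE.
Qed.

(** Each round commits one cop to a good shift. With [i.+1] rounds to go, only [i.+1 + k] cops are
    still free to catch the robber modulo the larger subgroup. *)
Lemma forces_greedy (H : {group G}) (X : {set G}) j k :
  H != [set: G] :> {set G} -> X \subset A ->
  (forall (d : G) i, d \notin H -> (i < j)%N ->
     forces (H <*> <[d]>)%g A (i.+1 + k)) ->
  (forall Y : {set G}, Y \subset A ->
     (#|Y| * (#|G| - #|H|) ^ j <= #|X| * (#|G| - #|coset_cover H A|) ^ j)%N ->
     forces H (moves H Y) k) ->
  forces H (moves H X) (j + k).
Proof.
move=> HT; elim: j X => [|j IH] X XA Fd FY.
  by apply: FY; rewrite // !expn0.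
have [d dH leX] := exists_good_shift X HT.
apply: (moves_commit (d := d)).
  by apply: forces_sub _ (Fd d j dH _) => //; exact: subsetIl.
have X'A : [set x in X | x + d \notin coset_cover H A] \subset A.
  by apply: subset_trans XA; apply/subsetP => x; rewrite inE => /andP[].
apply: IH => // [d' i d'H ij|Y YA leY]; first by apply: Fd => //; exact: ltnW.
apply: FY => //; rewrite !expnS mulnCA.
apply: leq_trans (leq_mul (leqnn _) leY) _.
by rewrite mulnA [X in (_ <= X)%N]mulnA leq_mul // mulnC.
Qed.

End DifferenceGame.

(** * From the difference game to strategies on the Cayley graph *)

Lemma mkseq_head (T : Type) (f : nat -> T) n :
  mkseq f n.+1 = f 0%N :: mkseq (fun t => f t.+1) n.
Proof. by rewrite /mkseq /= (iotaDl 1 0) -map_comp. Qed.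

Section Strategies.
Variables (G : finZmodType) (S : {set G}).
Let A : {set G} := 0 |: S.

Lemma cr_step_CayE (u v : G) : cr_step (Cay S) u v = (v - u \in A).
Proof. by rewrite /cr_step /Cay !inE subr_eq0 eq_sym. Qed.

(** Here [r] is the current robber position and [rho] the positions still to come. By induction on
    the win, choose a continuation for each next position. *)
Lemma wins_strategy k (delta : 'I_k -> G) (r : G) (c : 'I_k -> G) :
  wins A [set 0] A delta -> (forall i, delta i = r - c i) ->
  exists sigma : cop_strategy G k,
    [/\ sigma [::] = c, legal_cops (Cay S) sigma &
      forall rho, legal_robber (Cay S) rho -> cr_step (Cay S) r (rho 0%N) ->
        (exists i, c i = r) \/
        exists t i, sigma (mkseq rho t.+1) i = rho t].
Proof.
move=> W; elim: W r c => {delta} [delta i d0|delta s sA _ IH] r c dE.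
  exists (fun _ => c); split=> // [h v j|rho _ _]; first by rewrite /cr_step eqxx.
  left; exists i; apply/esym/eqP; rewrite -subr_eq0 -dE.
  by move: d0; rewrite inE.
have step v : exists tau : cop_strategy G k, v - r \in A ->
    [/\ tau [::] = (fun i => c i + s (v - r) i), legal_cops (Cay S) tau &
      forall rho, legal_robber (Cay S) rho -> cr_step (Cay S) v (rho 0%N) ->
        (exists i, c i + s (v - r) i = v) \/
        exists t i, tau (mkseq rho t.+1) i = rho t].
  have [vr|vr] := boolP (v - r \in A); last by exists (fun _ => c).
  have [|tau tauP] := IH (v - r) vr v (fun i => c i + s (v - r) i).
    by move=> i; rewrite dE opprD [RHS]addrA; congr (_ - _);
      rewrite [LHS]addrC addrA subrK.
  by exists tau => _.
have [f fP] := choice step.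
(* After an illegal robber move the cops stay at [c], which keeps [sigma] legal on all histories. *)
pose sigma (h : seq G) := if h is v :: h' then
  (if v - r \in A then f v h' else c) else c.
exists sigma; split=> //.
  case=> [|w h] v i; rewrite cr_step_CayE /= /sigma.
    case: ifPn => [vr|_]; last by rewrite subrr !inE eqxx.
    by have [-> _ _] := fP _ vr; rewrite addrC addKr sA.
  case: ifPn => [wr|_]; last by rewrite subrr !inE eqxx.
  by have [_ L _] := fP _ wr; rewrite -cr_step_CayE.
move=> rho Lrho; rewrite cr_step_CayE => r0; right.
have [f0 _ /(_ (fun t => rho t.+1))] := fP _ r0.
case=> [t||[i ci]|[t [i fi]]]; [exact: Lrho|exact: Lrho| |].
- by exists 0%N, i; rewrite /= r0 f0.
- by exists t.+1, i; rewrite mkseq_head -fi /sigma r0.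
Qed.

Lemma forces_cop_number k :
  forces A [set 0] A k -> (cop_number (Cay S) <= k)%N.
Proof.
move=> F; apply: (cop_numberP (Cay S)).2.
have step v : exists tau : cop_strategy G k,
    [/\ tau [::] = (fun=> 0), legal_cops (Cay S) tau &
      forall rho, legal_robber (Cay S) rho -> cr_step (Cay S) v (rho 0%N) ->
        (exists i : 'I_k, 0 = v) \/
        exists t i, tau (mkseq rho t.+1) i = rho t].
  by apply: (wins_strategy (F (fun=> v))) => i; rewrite subr0.
have [f fP] := choice step.
pose sigma (h : seq G) := if h is v :: h' then f v h' else (fun=> 0).
exists sigma; split.
  case=> [|w h] v i; have [E L _] := fP v; first by rewrite /= E /cr_step eqxx.
  by have [_ Lw _] := fP w; exact: Lw.
move=> rho Lrho; have [f0 _ /(_ (fun t => rho t.+1))] := fP (rho 0%N).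
case=> [t||[i ci]|[t [i fi]]]; [exact: Lrho|exact: Lrho| |].
- by exists 0%N, i; left.
- by exists t.+1, i; right; rewrite mkseq_head -fi.
Qed.

End Strategies.

(** * Real estimates and the count of cops *)

Section Estimates.
Variable R : realType.

(** This is [x <= exp (x - 1)] at [x = c * r]. *)
Lemma mul_expRN_le (r c : R) : 0 < c ->
  r * expR (- (c * r)) <= (c * expR 1)^-1.
Proof.
move=> c0; rewrite expRN.
have e0 := expR_gt0 (c * r); have e1 := expR_gt0 (1 : R).
rewrite -ler_pdivlMr ?invr_gt0 // invrK -[leRHS]mulrC -ler_pdivrMr; last first.
  by rewrite invr_gt0 mulr_gt0.
rewrite invrK mulrCA mulrA.
have := expR_ge1Dx (c * r - 1); rewrite addrC subrK expRD expRN.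
by rewrite ler_pdivlMr.
Qed.

(** With [r = q - 1], the ratio [(m - q) / (m - 1)] is at most [exp (- r / (m - 1))]. In [q = 1 + r]
    the first summand contributes at most 1, the second is bounded by [mul_expRN_le] with
    [c / sqrt m] for [c]. *)
Lemma greedy_remainder (c m q : R) (y j : nat) :
  0 < c -> 1 < m -> 1 <= q -> q <= m -> c * Num.sqrt m <= j%:R ->
  y%:R * (m - 1) ^+ j <= q * (m - q) ^+ j ->
  y%:R <= 1 + Num.sqrt m / (c * expR 1).
Proof.
move=> c0 m1 q1 qm jm ym.
have m0 : 0 < m - 1 by lra.
have sm0 : 0 < Num.sqrt m by rewrite sqrtr_gt0; lra.
have smE : m = Num.sqrt m ^+ 2 by rewrite sqr_sqrtr; lra.
pose r := q - 1.
have r0 : 0 <= r by rewrite /r; lra.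
have y1 : y%:R <= q * expR (- (j%:R * (r / (m - 1)))).
  rewrite -(ler_pM2r (exprn_gt0 j m0)); apply: le_trans ym _.
  rewrite -mulrA; apply: ler_wpM2l; first lra.
  rewrite -mulrN expRM_natl -exprMn; apply: lerXn2r; rewrite ?nnegrE; first lra.
    by rewrite mulr_ge0 ?expR_ge0; lra.
  apply: le_trans (ler_wpM2r (ltW m0) (expR_ge1Dx _)).
  by rewrite mulrDl mulNr mul1r divfK /r; lra.
have e1 : expR (- (j%:R * (r / (m - 1)))) <= expR (- (c / Num.sqrt m * r)).
  rewrite ler_expR lerN2.
  have -> : j%:R * (r / (m - 1)) = j%:R / (m - 1) * r by field; lra.
  rewrite ler_wpM2r // ler_pdivlMr // mulrAC ler_pdivrMr //.
  apply: le_trans (ler_wpM2r (ltW sm0) jm).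
  rewrite -mulrA -expr2 -smE; apply: ler_wpM2l; lra.
have e2 : expR (- (j%:R * (r / (m - 1)))) <= 1.
  rewrite -[leRHS]expR0 ler_expR oppr_le0.
  by apply: mulr_ge0; rewrite ?ler0n //; apply: divr_ge0; rewrite ?(ltW m0).
apply: le_trans y1 _; rewrite -[q](subrK 1) -/r mulrDl mul1r addrC.
apply: lerD => //; apply: le_trans (ler_wpM2l r0 e1) _.
apply: le_trans (mul_expRN_le _ _) _; first by rewrite divr_gt0.
by rewrite le_eqVlt; apply/orP; left; apply/eqP; field; rewrite ?gt_eqF ?expR_gt0.
Qed.

Lemma forces_index (G : finZmodType) (A : {set G}) (p : nat) (c C : R) :
  (forall a, a \in A -> - a \in A) -> 0 \in A -> <<A>>%g = [set: G] ->
  (forall d, 1 < d -> d %| #|G| -> p <= d)%N -> (0 < p)%N ->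
  0 < c -> c + (2 * c * expR 1)^-1 <= C -> c + C / Num.sqrt p%:R <= C ->
  forall (H : {group G}) (k : nat),
    C * Num.sqrt #|[set: G] : H|%g%:R + 5 / 2 < k%:R -> forces A H A k.
Proof.
move=> A_opp A0 A_gen p_min p0 c0 cC pC H k.
have e0 := expR_gt0 (1 : R).
have C0 : 0 < C by apply: lt_le_trans cC; rewrite addr_gt0 // invr_gt0 !mulr_gt0.
have cC' : c <= C by apply: le_trans cC; rewrite lerDl invr_ge0 !mulr_ge0 // ltW.
have [N] := ubnP #|~: H|; elim: N H k => // N IH H k; rewrite ltnS => leN kH.
have [HT|HT] := eqVneq (H : {set G}) [set: G].
  apply: forces_full => //; rewrite -(ltr_nat R); apply: le_lt_trans kH.
  have := mulr_ge0 (ltW C0) (sqrtr_ge0 #|[set: G] : H|%g%:R).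
  by rewrite -[0%:R]/(0 : R); lra.
set m := #|[set: G] : H|%g in kH.
have mh : (#|H| * m = #|G|)%N by rewrite Lagrange ?subsetT // cardsT.
have h0 : (0 < #|H|)%N := cardG_gt0 H.
have m1 : (1 < m)%N by rewrite indexg_gt1; apply: contra HT; rewrite eqEsubset subsetT.
have [X [XA AX leX]] := coset_cover_transversal H A.
set sm := Num.sqrt m%:R in kH.
have sm0 : 0 < sm by rewrite sqrtr_gt0 ltr0n ltnW.
pose j := (Num.trunc (c * sm)).+1.
have csm0 : 0 <= c * sm by rewrite mulr_ge0 // ltW.
have /andP[jle jgt] : j%:R - 1 <= c * sm < j%:R.
  by have := truncn_itv csm0; rewrite -[(Num.trunc _)%:R](addrK 1) natr1.
have csC : c * sm <= C * sm by rewrite ler_wpM2r // ltW.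
have jk : (j <= k)%N by rewrite -(ler_nat R); lra.
rewrite -(subnKC jk).
apply: (@forces_sub _ _ _ _ (moves A H X)); first by rewrite subsetI subxx.
have kjE : (k - j)%:R = k%:R - j%:R :> R by rewrite natrB.
apply: forces_greedy => // [d i dH ij|Y YA leY].
  have HH' := join_cycle_proper dH.
  apply: (IH (H <*> <[d]>)%G).
    by apply: leq_trans leN; apply: proper_card; rewrite properC; exact: HH'.
  set m' := #|_ : _|%g.
  have pm : (p * m' <= m)%N.
    have E : (m' * #|(H <*> <[d]>)%G : H|%g = m)%N.
      by rewrite Lagrange_index ?subsetT //; exact: proper_sub HH'.
    rewrite -E mulnC leq_mul2l p_min ?orbT //.
      by rewrite indexg_gt1; case/andP: HH'.
    apply: dvdn_trans (dvdn_indexg _ _) _.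
    by rewrite -cardsT; apply: cardSg; exact: subsetT.
  have sp0 : 0 < Num.sqrt (p%:R : R) by rewrite sqrtr_gt0 ltr0n.
  have sm' : Num.sqrt m'%:R * Num.sqrt p%:R <= sm.
    by rewrite -sqrtrM ?ler0n // ler_wsqrtr // -natrM ler_nat mulnC.
  have : C * Num.sqrt m'%:R <= C / Num.sqrt p%:R * sm.
    by rewrite -mulrA ler_wpM2l ?(ltW C0) // mulrC ler_pdivlMr.
  have : C / Num.sqrt p%:R * sm <= (C - c) * sm.
    by rewrite ler_wpM2r ?(ltW sm0) // lerBrDl.
  (* The extra cop in [i.+1] pays for rounding [j] up, so the constant [5 / 2] survives the
     induction. *)
  rewrite natrD kjE -natr1 mulrBl.
  have : 0 <= i%:R :> R by rewrite ler0n.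
  lra.
apply: forces_half => // _.
have X0 : (0 < #|X|)%N.
  have /coset_coverP[x xX _] := subsetP AX _ A0.
  by apply/card_gt0P; exists x.
have Xm : (#|X| <= m)%N.
  rewrite -(leq_pmul2r h0) (mulnC m) mh; apply: leq_trans leX _.
  exact: max_card.
have : #|Y|%:R <= 1 + sm / (c * expR 1).
  apply: (@greedy_remainder _ _ #|X|%:R _ j) => //.
  - by rewrite ltr1n.
  - by rewrite ler1n.
  - by rewrite ler_nat.
  - exact: ltW.
  rewrite -[1]/(1%:R) -!natrB ?(ltnW m1) // -!natrX -!natrM ler_nat.
  (* Multiplying by [|H| ^ j] turns [m - 1] into [|G| - |H|] and [m - |X|] into [|G| - |X| |H|],
     which is at least [|G| - |A + H|]. *)
  have hj0 : (0 < #|H| ^ j)%N by rewrite expn_gt0 h0.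
  rewrite -(leq_pmul2r hj0) -!mulnA -!expnMn !mulnBl mul1n (mulnC m) mh.
  apply: leq_trans leY _; rewrite leq_mul2l leq_exp2r // orbC.
  by rewrite leq_sub2l.
have half : (#|Y|./2)%:R * 2 <= #|Y|%:R :> R.
  by rewrite -natrM ler_nat muln2 -[leqRHS]odd_double_half leq_addl.
have : (c + (2 * c * expR 1)^-1) * sm <= C * sm by rewrite ler_wpM2r // ltW.
have -> : sm / (c * expR 1) = 2 * ((2 * c * expR 1)^-1 * sm).
  by field; rewrite !gt_eqF.
rewrite mulrDl => h1 h2; rewrite -(ltr_nat R) kjE.
lra.
Qed.

Lemma cop_number_Cay_le (G : finZmodType) (S : {set G}) (c C : R) :
  <<S>>%g = [set: G] -> S = [set - x | x in S] -> (1 < #|G|)%N ->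
  0 < c -> c + (2 * c * expR 1)^-1 <= C ->
  c + C / Num.sqrt (pdiv #|G|)%:R <= C ->
  (cop_number (Cay S))%:R <= C * Num.sqrt #|G|%:R + 7 / 2.
Proof.
move=> gen_S opp_S G1 c0 cC pC.
have e0 := expR_gt0 (1 : R).
have C0 : 0 < C by apply: lt_le_trans cC; rewrite addr_gt0 // invr_gt0 !mulr_gt0.
set x := C * Num.sqrt #|G|%:R.
have x0 : 0 <= x by rewrite mulr_ge0 ?sqrtr_ge0 // ltW.
have x52 : 0 <= x + 5 / 2 by lra.
have /andP[kle kgt] := truncn_itv x52.
(* This integer exceeds [x + 5 / 2] strictly and is at most [x + 7 / 2]. *)
have : (cop_number (Cay S) <= (Num.trunc (x + 5 / 2)).+1)%N.
  apply: forces_cop_number.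
  apply: (@forces_index _ _ (pdiv #|G|) c C _ _ _ _ _ _ _ _ 1%G) => //.
  - move=> a; rewrite !inE oppr_eq0 => /orP[->//|aS].
    by rewrite opp_S (imset_f _ aS) orbT.
  - by rewrite !inE eqxx.
  - apply/eqP; rewrite eqEsubset subsetT -gen_S genS //.
    by apply/subsetP => a aS; rewrite inE aS orbT.
  - by move=> d d1 dG; apply: pdiv_min_dvd.
  - by rewrite indexg1 cardsT.
rewrite -(ler_nat R) -natr1 => kn; move: kle; lra.
Qed.

End Estimates.

(** * Choice of the constants *)

Theorem proposition3p9 (R : realType) (G : finZmodType) (S : {set G})
    (n p : nat) (card_G : #|G| = n)
    (gen_S : <<S>>%g = [set: G]) (opp_S : S = [set - x | x in S])
    (S0 : 0 \notin S) (p_def : p = pdiv n) :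
  (p = 3%N ->
     (cop_number (Cay S))%:R <=
       Num.sqrt (3 / (2 * (Num.sqrt 3 - 1) * expR 1)) * Num.sqrt n%:R
         + 7 / 2 :> R) /\
  ((5 <= p)%N ->
     (cop_number (Cay S))%:R <=
       Num.sqrt (2 / expR 1) * Num.sqrt n%:R + 7 / 2 :> R).
Proof.
have e0 : 0 < expR 1 :> R := expR_gt0 1.
have G1 : (1 < p)%N -> (1 < #|G|)%N.
  rewrite p_def card_G; case: n {card_G p_def} => [|[|n]] //.
split=> [p3|p5]; rewrite -card_G.
  set s3 := Num.sqrt 3.
  have s3E : s3 * s3 = 3 :> R by rewrite -expr2 sqr_sqrtr.
  have s30 : 0 <= s3 :> R := sqrtr_ge0 _.
  have s31 : 1 < s3 :> R by nra.
  set C := Num.sqrt (3 / _).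
  have d0 : 0 < 2 * (s3 - 1) * expR 1 :> R by rewrite !mulr_gt0 // subr_gt0.
  have C0 : 0 < C by rewrite sqrtr_gt0 divr_gt0.
  have CE : C * C = 3 / (2 * (s3 - 1) * expR 1).
    by rewrite -expr2 sqr_sqrtr // divr_ge0 // ltW.
  (* Both constraints on [c] and [C] hold with equality. *)
  apply: (@cop_number_Cay_le _ _ _ (C * (1 - s3^-1))) => //.
  - by apply: G1; rewrite p3.
  - by rewrite mulr_gt0 // subr_gt0 invf_lt1 //; lra.
  - have -> : (2 * (C * (1 - s3^-1)) * expR 1)^-1 = C * s3^-1.
      apply: mulr1_eq.
      have -> : 2 * (C * (1 - s3^-1)) * expR 1 * (C * s3^-1) =
          C * C * (2 * (s3 - 1) * expR 1) / (s3 * s3).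
        by field; rewrite gt_eqF // (lt_trans ltr01 s31).
      by rewrite CE s3E divfK ?(gt_eqF d0) // divff ?pnatr_eq0.
    by rewrite -mulrDr subrK mulr1.
  - by rewrite card_G -p_def p3 -/s3 -mulrDr subrK mulr1.
set C := Num.sqrt (2 / _).
have C0 : 0 < C by rewrite sqrtr_gt0 divr_gt0.
have CE : C * C * expR 1 = 2.
  by rewrite -expr2 sqr_sqrtr ?divr_ge0 ?ltW // divfK ?gt_eqF.
apply: (@cop_number_Cay_le _ _ _ (C / 2)) => //.
- by apply: G1; exact: leq_trans p5.
- by rewrite divr_gt0.
- have -> : (2 * (C / 2) * expR 1)^-1 = C / 2.
    apply: mulr1_eq; have -> : 2 * (C / 2) * expR 1 * (C / 2) = C * C * expR 1 / 2.
      by field.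
    by rewrite CE divff ?pnatr_eq0.
  lra.
- rewrite card_G -p_def.
  (* With [c = C / 2] the constraint on [p] reduces to [sqrt p >= 2]. *)
  have s2 : 2 <= Num.sqrt (p%:R : R).
    have -> : 2 = Num.sqrt (2 ^+ 2) :> R by rewrite sqrtr_sqr ger0_norm.
    by rewrite ler_wsqrtr // -natrX ler_nat; apply: leq_trans p5.
  have : C / Num.sqrt p%:R <= C / 2.
    by rewrite ler_wpM2l ?(ltW C0) // lef_pV2 // posrE; lra.
  lra.
Qed.
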